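(* For any form parameter $Q$, a nonsingular $Q$-form $\underline\mu$ is absorbing if and only if $\underline\mu$ is indefinite and full.
   Context: All abelian groups are finitely generated. A form parameter is a triple $Q=(Q_e,h,p)$ with homomorphisms $h\colon Q_e\to\mathbb{Z}$, $p\colon\mathbb{Z}\to Q_e$ such that $hph=2h$, $php=2p$; its symmetry $\epsilon_Q\in\{\pm1\}$ is given by $hp=(1+\epsilon_Q)\mathrm{Id}_{\mathbb{Z}}$. The linearisation of $Q$ is $SQ:=Q_e/p(\mathbb{Z})$. A $Q$-form $\underline\mu=(X,\lambda,\mu)$: an abelian group $X$, a bilinear $\lambda\colon X\times X\to\mathbb{Z}$ with $\lambda(x,y)=\epsilon_Q\lambda(y,x)$, and a function $\mu\colon X\to Q_e$ with $\mu(x+y)=\mu(x)+\mu(y)+p(\lambda(x,y))$, $h(\mu(x))=\lambda(x,x)$. It is nonsingular if the adjoint $X\to\mathrm{Hom}(X,\mathbb{Z})$ of $\lambda$ is an isomorphism (so $X$ is free). The composition $S\mu\colon X\xrightarrow{\mu}Q_e\to SQ$ is a homomorphism; $\underline\mu$ is full if $S\mu$ is onto. $\underline\mu$ is indefinite if $(X,\lambda)$ is indefinite, i.e. neither positive definite nor negative definite (the form on $X=0$ is regarded as definite; every nonzero nonsingular anti-symmetric form is indefinite). A morphism of $Q$-forms $(X,\lambda,\mu)\to(X',\lambda',\mu')$ is a homomorphism $f\colon X\to X'$ with $\lambda'(f(x),f(y))=\lambda(x,y)$ and $\mu'(f(x))=\mu(x)$; it is a primitive embedding if it is injective with image a direct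 summand. $k\underline\mu$ denotes the $k$-fold orthogonal sum of $\underline\mu$. A nonsingular $Q$-form $\underline\mu$ is absorbing if for every nonsingular $Q$-form $\underline\mu'$ there is a primitive embedding $\underline\mu'\hookrightarrow k\underline\mu$ for some positive integer $k$. *)

(* Defs.v *)
From HB Require Import structures.
From mathcomp Require Import all_boot all_order all_algebra.
From mathcomp Require Import boolp.
From mathcomp Require Import zify.

Set Implicit Arguments.
Unset Strict Implicit.
Unset Printing Implicit Defensive.

Import GRing.Theory.

Local Open Scope ring_scope.
Local Open Scope quotient_scope.

Definition finitely_generated (A : zmodType) : Prop :=
  exists (n : nat) (g : 'I_n -> A),
    forall x : A, exists c : 'I_n -> int, x = \sum_i g i *~ c i.

Record form_parameter := FormParameter {
  fp_group :> zmodType;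
  fp_fg : finitely_generated fp_group;
  fp_h : {additive fp_group -> int};
  fp_p : {additive int -> fp_group};
  fp_hph : forall q, fp_h (fp_p (fp_h q)) = fp_h q *+ 2;
  fp_php : forall n, fp_p (fp_h (fp_p n)) = fp_p n *+ 2
}.

Section FormParameterTheory.
Variable Q : form_parameter.

(* The homomorphism h \o p is multiplication by h (p 1), so this is the only
   possible value of epsilon; see fp_hpE and fp_symP. *)
Definition fp_sym : int := fp_h Q (fp_p Q 1) - 1.

Lemma fp_hpE n : fp_h Q (fp_p Q n) = (1 + fp_sym) * n.
Proof.
by rewrite /fp_sym addrC subrK -[in LHS](intz n) !raddfMz -mulrzr intz.
Qed.

Lemma fp_symP : fp_sym = 1 \/ fp_sym = -1.
Proof.
have := congr1 (fp_h Q) (fp_php Q 1); rewrite raddfMn /= !fp_hpE !mulr1.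
by set e := fp_sym; nia.
Qed.

Definition im_p : {pred Q} := fun q => `[< exists n : int, fp_p Q n = q >].

Lemma im_p_zmod_closed : zmod_closed im_p.
Proof.
split=> [|x y /asboolP[m <-] /asboolP[n <-]]; apply/asboolP.
  by exists 0; rewrite raddf0.
by exists (m - n); rewrite raddfB.
Qed.

HB.instance Definition _ := GRing.isZmodClosed.Build Q im_p im_p_zmod_closed.

Definition linearisation : zmodType := Quotient.quot im_p.

Definition to_linearisation (q : Q) : linearisation :=
  \pi_(Quotient.quot im_p) q.

End FormParameterTheory.

Record qform (Q : form_parameter) := QForm {
  qf_group :> zmodType;
  qf_fg : finitely_generated qf_group;
  qf_lam : qf_group -> qf_group -> int;
  qf_mu : qf_group -> Q;
  qf_lamDl : forall x x' y, qf_lam (x + x') y = qf_lam x y + qf_lam x' y;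
  qf_lamDr : forall x y y', qf_lam x (y + y') = qf_lam x y + qf_lam x y';
  qf_lamC : forall x y, qf_lam x y = fp_sym Q * qf_lam y x;
  qf_muD : forall x y, qf_mu (x + y) = qf_mu x + qf_mu y + fp_p Q (qf_lam x y);
  qf_hmu : forall x, fp_h Q (qf_mu x) = qf_lam x x
}.

Section QFormTheory.
Variables (Q : form_parameter) (M : qform Q).

Lemma qf_lam_zmod_morphism (x : M) : zmod_morphism (qf_lam x).
Proof. by move=> y z; apply/(canRL (addrK _)); rewrite -qf_lamDr subrK. Qed.

Definition adjoint (x : M) : {additive M -> int} :=
  HB.pack (qf_lam x)
    (GRing.isZmodMorphism.Build M int (qf_lam x) (qf_lam_zmod_morphism x)).

(* The adjoint is additive for the pointwise addition on Hom(X, Z) by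
   qf_lamDl, so it is an isomorphism as soon as it is bijective. *)
Definition nonsingular : Prop := bijective adjoint.

Definition Smu (x : M) : linearisation Q := to_linearisation (qf_mu x).

Lemma SmuD (x y : M) : Smu (x + y) = Smu x + Smu y.
Proof.
rewrite /Smu /to_linearisation -[RHS](@pi_addr _ _ _ _ _ (Quotient.quot (@im_p Q))).
apply/eqP; rewrite -Quotient.idealrBE qf_muD addrC addKr.
by apply/asboolP; exists (qf_lam x y).
Qed.

Definition full : Prop := forall s : linearisation Q, exists x : M, Smu x = s.

Definition positive_definite : Prop := forall x : M, x != 0 -> 0 < qf_lam x x.
Definition negative_definite : Prop := forall x : M, x != 0 -> qf_lam x x < 0.
Definition indefinite : Prop := ~ positive_definite /\ ~ negative_definite.

End QFormTheory.

Section OrthogonalSum.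
Variables (Q : form_parameter) (k : nat) (M : qform Q).

Definition kfold_lam (x y : {ffun 'I_k -> M}) : int :=
  \sum_i qf_lam (x i) (y i).
Definition kfold_mu (x : {ffun 'I_k -> M}) : Q := \sum_i qf_mu (x i).

Fact kfold_fg : finitely_generated {ffun 'I_k -> M}.
Proof.
have [n [g gP]] := qf_fg M.
pose T : finType := ('I_k * 'I_n)%type.
pose gT (t : T) : {ffun 'I_k -> M} := [ffun i => if i == t.1 then g t.2 else 0].
exists #|T|, (fun j => gT (enum_val j)) => x.
have [c cP] := choice (fun i => gP (x i)).
exists (fun j => c (enum_val j).1 (enum_val j).2).
rewrite -(big_enum_val (fun t : T => gT t *~ c t.1 t.2)) /=.
rewrite -(pair_bigA _ (fun i j => gT (i, j) *~ c i j)) /=.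
apply/ffunP => i; rewrite sum_ffunE (bigD1 i) //= [X in _ + X]big1 => [|l ne].
  rewrite addr0 sum_ffunE cP; apply: eq_bigr => j _.
  by rewrite ffunMzE ffunE eqxx.
rewrite sum_ffunE big1 // => j _.
by rewrite ffunMzE ffunE eq_sym (negPf ne) mul0rz.
Qed.

Fact kfold_lamDl x x' y : kfold_lam (x + x') y = kfold_lam x y + kfold_lam x' y.
Proof. by rewrite -big_split; apply: eq_bigr => i _; rewrite ffunE qf_lamDl. Qed.

Fact kfold_lamDr x y y' : kfold_lam x (y + y') = kfold_lam x y + kfold_lam x y'.
Proof. by rewrite -big_split; apply: eq_bigr => i _; rewrite ffunE qf_lamDr. Qed.

Fact kfold_lamC x y : kfold_lam x y = fp_sym Q * kfold_lam y x.
Proof. by rewrite mulr_sumr; apply: eq_bigr => i _; rewrite -qf_lamC. Qed.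

Fact kfold_muD x y :
  kfold_mu (x + y) = kfold_mu x + kfold_mu y + fp_p Q (kfold_lam x y).
Proof.
rewrite raddf_sum -!big_split; apply: eq_bigr => i _.
by rewrite ffunE qf_muD.
Qed.

Fact kfold_hmu x : fp_h Q (kfold_mu x) = kfold_lam x x.
Proof. by rewrite raddf_sum; apply: eq_bigr => i _; rewrite qf_hmu. Qed.

Definition kfold : qform Q :=
  QForm kfold_fg kfold_lamDl kfold_lamDr kfold_lamC kfold_muD kfold_hmu.

End OrthogonalSum.

Definition qform_morphism (Q : form_parameter) (M N : qform Q)
    (f : {additive M -> N}) : Prop :=
  (forall x y, qf_lam (f x) (f y) = qf_lam x y) /\
  (forall x, qf_mu (f x) = qf_mu x).

Definition direct_summand (A : zmodType) (B : A -> Prop) : Prop :=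
  exists C : zmodClosed A,
    (forall x, B x -> x \in C -> x = 0) /\
    (forall x, exists b c, [/\ B b, c \in C & x = b + c]).

Definition primitive_embedding (Q : form_parameter) (M N : qform Q)
    (f : {additive M -> N}) : Prop :=
  [/\ qform_morphism f, injective f
    & direct_summand (fun y => exists x, f x = y)].

Definition absorbing (Q : form_parameter) (M : qform Q) : Prop :=
  forall N : qform Q, nonsingular N ->
    exists k : nat, (0 < k)%N /\
      exists f : {additive N -> kfold k M}, primitive_embedding f.

(* Main.v *)
Require Import Defs.
From HB Require Import structures.
From mathcomp Require Import all_boot all_order all_algebra.
From mathcomp Require Import boolp.
From mathcomp Require Import zify ring.

(** A morphism out of a nonsingular form is automatically a primitive embedding:
    the orthogonal complement of the image is a complement. So absorbing means
    that every nonsingular [N] maps to some [k M].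

    If [M] is absorbing, embed the rank 2 form with [lam = [[h q, 1], [eps, 0]]],
    [mu (1,0) = q] and [mu (0,1) = 0]: its isotropic vector rules out definite
    [M], and letting [q] vary gives fullness.

    Conversely, a morphism [N -> k M] is a way of writing the form of [N] as a sum
    of [k] pullbacks of the form of [M] along additive maps [N -> M]. Since [M] is
    nonsingular there are [v, w] with [lam v w = 1]; since [M] is indefinite, the
    norms of vectors of the [k M] form a subgroup of [Z], so adding orthogonal
    copies makes [v, w] isotropic. As [mu (- v) = - mu v] for isotropic [v], the
    vectors [(v, - v, 0)] and [(w, 0, - w)] form a hyperbolic pair on which [mu]
    vanishes. With fullness, [mu] then takes every value of [Q_e] on the [k M].
    Writing the identity of [N] as a sum of rank one maps [x |-> phi x * e]
    decomposes the form of [N] into pullbacks of rank one and hyperbolic forms. *)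

Set Implicit Arguments.
Unset Strict Implicit.
Unset Printing Implicit Defensive.

Import Order.TTheory GRing.Theory Num.Theory.
Local Open Scope ring_scope.

(** * Additive maps to the integers and their images *)

Section Additive.
Variables U V : zmodType.

Definition additive_of (f : U -> V) (fB : zmod_morphism f) : {additive U -> V} :=
  HB.pack f (GRing.isZmodMorphism.Build U V f fB).

Lemma additive_eq (f g : {additive U -> V}) : f =1 g -> f = g.
Proof.
case: f g => [f [[f1]]] [g [[g1]]] /= fg.
have {}fg : f = g := funext fg.
by subst g; rewrite (Prop_irrelevance f1 g1).
Qed.

Lemma additiveMz (f : {additive U -> V}) x n : f (x *~ n) = f x *~ n.
Proof. exact: raddfMz. Qed.

End Additive.

Lemma mulrz_int (m n : int) : m *~ n = m * n.
Proof. by rewrite -mulrzr intz. Qed.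

(** Subgroups of [int] are cyclic: unless [f] is zero, [f e] is the least positive value of [f], and
    [g] divides by it. *)
Lemma additive_int_image (A : zmodType) (f : {additive A -> int}) :
  exists e : A, exists g : {additive A -> int}, forall x, f x = g x * f e.
Proof.
have [f0|/existsNP[a /eqP fa]] := pselect (forall x, f x = 0).
  by exists 0, f => x; rewrite !f0 mulr0.
pose P n := `[< exists x, f x = n.+1 >].
have exP : exists n, P n.
  exists `|f a|%N.-1; apply/asboolP.
  by case: (ltrP 0 (f a)) => lt; [exists a | exists (- a); rewrite raddfN /=]; move: fa lt;
    set m := f a; lia.
case: (ex_minnP exP) => d /asboolP[e fe] dmin.
have dv x : f x = (f x %/ d.+1)%Z * d.+1.
  have := divz_eq (f x) d.+1; set q := (_ %/ _)%Z; set r := (_ %% _)%Z => fx.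
  have [r0 rd] : 0 <= r /\ r < d.+1 by split; [exact: modz_ge0 | exact: ltz_pmod].
  have fxe : f (x - e *~ q) = r.
    by rewrite raddfB /= additiveMz fe mulrz_int {1}fx; ring.
  case: (ltrP 0 r) => rpos; last by lia.
  have := dmin `|r|%N.-1; have -> : P `|r|%N.-1; last by lia.
  by apply/asboolP; exists (x - e *~ q); rewrite fxe; lia.
have gB : zmod_morphism (fun x => (f x %/ d.+1)%Z).
  move=> x y /=; have := dv (x - y); rewrite raddfB /= {1}(dv x) {1}(dv y).
  by move=> E; apply: (@mulIf _ (d.+1 : int)) => //; rewrite -E; ring.
by exists e, (additive_of gB) => x; rewrite fe; exact: dv.
Qed.

(** * Symmetry, unimodular pairs and hyperbolic pairs *)

Section Form.
Variables (Q : form_parameter) (M : qform Q).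
Implicit Types x y z : M.
Notation lam := (@qf_lam Q M).
Notation mu := (@qf_mu Q M).
Notation eps := (fp_sym Q).
Notation h := (fp_h Q).
Notation p := (fp_p Q).

Lemma fp_sym_sqr : eps * eps = 1.
Proof. by have [-> | ->] := fp_symP Q. Qed.

Lemma fp_sym_h q : eps * h q = h q.
Proof. by have := fp_hph q; rewrite fp_hpE; lia. Qed.

(** Under [p] the order of the arguments of [lam] is immaterial. *)
Lemma fp_p_sym n : p (eps * n) = p n.
Proof.
have := fp_php Q n; rewrite fp_hpE mulrDl mul1r raddfD /= mulr2n.
exact: addrI.
Qed.

Lemma qf_lamr_zmod y : zmod_morphism (fun x => lam x y).
Proof. by move=> x z; apply/(canRL (addrK _)); rewrite -qf_lamDl subrK. Qed.

Lemma qf_lamNr x y : lam x (- y) = - lam x y.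
Proof. exact: (raddfN (adjoint x)). Qed.
Lemma qf_lam0r x : lam x 0 = 0.
Proof. exact: (raddf0 (adjoint x)). Qed.
Lemma qf_lamMzr x y n : lam x (y *~ n) = lam x y * n.
Proof. by rewrite -mulrz_int; exact: (additiveMz (adjoint x)). Qed.
Lemma qf_lamNl x y : lam (- x) y = - lam x y.
Proof. by rewrite qf_lamC qf_lamNr mulrN -qf_lamC. Qed.
Lemma qf_lam0l x : lam 0 x = 0.
Proof. by rewrite qf_lamC qf_lam0r mulr0. Qed.
Lemma qf_lamMzl x y n : lam (x *~ n) y = lam x y * n.
Proof. by rewrite qf_lamC qf_lamMzr mulrA -qf_lamC. Qed.

Lemma qf_mu0 : mu 0 = 0.
Proof.
have := qf_muD (0 : M) 0; rewrite addr0 qf_lam0r raddf0 addr0.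
by move/eqP; rewrite -[X in X == _]addr0 => /eqP/addrI.
Qed.

Lemma qf_muN x : mu (- x) = p (lam x x) - mu x.
Proof.
have := qf_muD x (- x); rewrite subrr qf_mu0 qf_lamNr raddfN /=.
by move/esym/eqP; rewrite subr_eq0 => /eqP <-; rewrite addrC addKr.
Qed.


Lemma nonsingular_lam_eq0 x : nonsingular M -> (forall y, lam x y = 0) -> x = 0.
Proof.
move=> /bij_inj inj x0; apply: inj; apply: additive_eq => y.
by rewrite /= x0 qf_lam0l.
Qed.

Lemma nonsingular_represent (f : {additive M -> int}) :
  nonsingular M -> exists x, forall y, lam x y = f y.
Proof. by case=> g _ gK; exists (g f) => y; rewrite -[in RHS](gK f). Qed.

(** Division by the generator [lam x w] of the image of [lam x] is a functional with value 1 at [w];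
    [v] represents it. *)
Lemma nonsingular_unimodular_pair x :
  nonsingular M -> x != 0 -> exists v w, lam v w = 1.
Proof.
move=> nsM x0; have [w [g gP]] := additive_int_image (adjoint x).
have xw : lam x w != 0.
  apply: contra_neq x0 => xw; apply: nonsingular_lam_eq0 => // y.
  by rewrite [LHS]gP [X in _ * X]xw mulr0.
have [v vP] := nonsingular_represent g nsM; exists v, w.
by rewrite vP; apply: (mulIf xw); rewrite mul1r [RHS]gP.
Qed.

Lemma semidefinite_definite (s : int) x :
  s * s = 1 -> nonsingular M -> eps = 1 -> x != 0 -> 0 <= s * lam x x ->
  exists y, 0 < s * lam y y.
Proof.
move=> s1 nsM e1 x0; rewrite le_eqVlt => /predU1P[|]; last by exists x.
move=> /esym xx0; have {}xx0 : lam x x = 0.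
  by rewrite -[LHS]mul1r -s1 -mulrA xx0 mulr0.
have [z xz] : exists z, lam x z <> 0.
  by apply/existsNP => xz; move/eqP: x0; apply; exact: nonsingular_lam_eq0.
have zx : lam z x = lam x z by rewrite qf_lamC e1 mul1r.
(* The multiple of the isotropic [x] is so large that the cross term [2 * b * b * (|c| + 1)]
   outweighs [s * c], where [b = lam x z] and [c = lam z z]. *)
exists (z + x *~ (s * lam x z * (`|lam z z| + 1))).
rewrite !qf_lamDl !qf_lamDr !(qf_lamMzl, qf_lamMzr) zx xx0.
set b := lam x z in xz *; set c := lam z z.
have -> : s * (c + b * (s * b * (`|c| + 1)) + (b * (s * b * (`|c| + 1)) +
    0 * (s * b * (`|c| + 1)) * (s * b * (`|c| + 1)))) =
  s * c + (s * s) * (b * b) * (`|c| + 1) * 2 by ring.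
rewrite s1 mul1r; have b1 : 1 <= b * b by nia.
have : s = 1 \/ s = -1 by nia.
by nia.
Qed.

(* A submonoid of [int] with elements of both signs is a subgroup. *)
Lemma indefinite_neg_norm v : nonsingular M -> indefinite M ->
  exists u : seq M, \sum_(x <- u) lam x x = - lam v v.
Proof.
move=> nsM [/existsNP[x /not_implyP[x0 /negP xx]]
            /existsNP[y /not_implyP[y0 /negP yy]]].
rewrite -leNgt in xx; rewrite -leNgt in yy.
have [->|v0] := eqVneq (lam v v) 0; first by exists [::]; rewrite big_nil oppr0.
have e1 : eps = 1.
  by apply: (mulIf v0); rewrite mul1r -qf_lamC.
have sum_nseq n (z : M) : \sum_(t <- nseq n z) lam t t = lam z z * n.
  by rewrite big_nseq iter_addr_0 -mulr_natr natz.
have [a a_lt0] : exists a, 0 < -1 * lam a a.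
  by apply: (semidefinite_definite _ nsM e1 x0); lia.
have [b b_gt0] : exists b, 0 < 1 * lam b b.
  by apply: (semidefinite_definite _ nsM e1 y0); lia.
have [v_lt0|v_ge0] := ltrP (lam v v) 0.
  (* With [m = lam b b > 0], the total is [lam v v * (m - 1) - lam v v * m]. *)
  exists (nseq `|lam b b - 1| v ++ nseq `|lam v v| b).
  by rewrite big_cat /= !sum_nseq; nia.
exists (nseq `|lam a a + 1| v ++ nseq `|lam v v| a).
by rewrite big_cat /= !sum_nseq; nia.
Qed.

(** A list of pairs holds the components of two vectors in a multiple of [M]. *)
Lemma hyperbolic_pair : nonsingular M -> indefinite M ->
  exists P : seq (M * M),
    [/\ \sum_(t <- P) mu t.1 = 0, \sum_(t <- P) mu t.2 = 0
      & \sum_(t <- P) lam t.1 t.2 = 1].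
Proof.
move=> nsM iM.
have [x [x0 _]] : exists x : M, x != 0 /\ ~ 0 < lam x x.
  by case: iM => [/existsNP[x /not_implyP[? ?]] _]; exists x.
have [v [w vw]] := nonsingular_unimodular_pair nsM x0.
have [s sE] := indefinite_neg_norm v nsM iM.
have [t tE] := indefinite_neg_norm w nsM iM.
(* The components from [s] and [t] cancel the norms of [v] and [w]; the zeros beside them leave the
   pairing equal to 1. *)
pose P := (v, w) :: [seq (z, 0) | z <- s] ++ [seq (0, z) | z <- t] : seq (M * M).
have P1 : \sum_(t <- P) lam t.1 t.1 = 0.
  rewrite big_cons big_cat !big_map /= sE [X in _ + (_ + X)]big1.
    by rewrite addr0 subrr.
  by move=> *; rewrite qf_lam0l.
have P2 : \sum_(t <- P) lam t.2 t.2 = 0.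
  rewrite big_cons big_cat !big_map /= tE [X in _ + (X + _)]big1.
    by rewrite add0r subrr.
  by move=> *; rewrite qf_lam0l.
have P12 : \sum_(t <- P) lam t.1 t.2 = 1.
  rewrite big_cons big_cat !big_map /= vw !big1 ?addr0 // => *.
    by rewrite qf_lam0l.
  by rewrite qf_lam0r.
exists (P ++ [seq (- r.1, 0) | r <- P] ++ [seq (0, - r.2) | r <- P]).
split; rewrite !big_cat !big_map /=.
- rewrite [X in _ + (_ + X)]big1; last by move=> *; rewrite qf_mu0.
  rewrite addr0 -big_split /=; under eq_bigr do rewrite qf_muN addrC subrK.
  by rewrite -raddf_sum P1 raddf0.
- rewrite [X in _ + (X + _)]big1; last by move=> *; rewrite qf_mu0.
  rewrite add0r -big_split /=; under eq_bigr do rewrite qf_muN addrC subrK.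
  by rewrite -raddf_sum P2 raddf0.
rewrite P12 !big1 ?addr0 // => *; first by rewrite qf_lam0l.
by rewrite qf_lam0r.
Qed.

End Form.

(** * Quadratic behaviour of [mu] on multiples *)

(* The binomial coefficient [n] choose 2, for [n] of either sign. *)
Definition tri (n : int) : int := (n * (n - 1) %/ 2)%Z.

Lemma triE n : tri n * 2 = n * (n - 1).
Proof.
have := divz_eq (n * (n - 1)) 2; rewrite -/(tri n).
have [r0 r1] : 0 <= (n * (n - 1) %% 2)%Z /\ (n * (n - 1) %% 2)%Z < 2.
  by split; [exact: modz_ge0 | exact: ltz_pmod].
move=> E.
have := divz_eq n 2.
have [s0 s1] : 0 <= (n %% 2)%Z /\ (n %% 2)%Z < 2.
  by split; [exact: modz_ge0 | exact: ltz_pmod].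
move: E r0 r1 s0 s1; set r := (_ %% _)%Z; set k := (n %/ 2)%Z.
set s := (n %% 2)%Z => E r0 r1 s0 s1 nE.
have nn : n * (n - 1) = (k * 2 * k + k * s * 2 - k) * 2 + s * (s - 1).
  by rewrite nE; ring.
have ss : s * (s - 1) = 0 by nia.
by lia.
Qed.

Lemma triD m n : tri (m + n) = tri m + tri n + m * n.
Proof.
apply: (@mulIf _ (2 : int)) => //.
by rewrite !mulrDl !triE; ring.
Qed.

Lemma qf_muMz Q (M : qform Q) (x : M) n :
  qf_mu (x *~ n) = qf_mu x *~ n + fp_p Q (qf_lam x x * tri n).
Proof.
(* An equivalence, so that the induction runs in both directions from 0. *)
have step m : (qf_mu (x *~ (m + 1)) = qf_mu x *~ (m + 1) +
    fp_p Q (qf_lam x x * tri (m + 1))) <->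
  (qf_mu (x *~ m) = qf_mu x *~ m + fp_p Q (qf_lam x x * tri m)).
  have t1 : tri 1 = 0 by [].
  rewrite !mulrzDr !mulr1z qf_muD qf_lamMzl triD t1 addr0 mulr1 mulrDr raddfD /=.
  rewrite (addrA (_ + _)) (addrAC (_ *~ m) (qf_mu x)).
  by split=> [/addIr/addIr|->].
elim/int_rect: n => [|n IH|n IH].
- by rewrite !mulr0z qf_mu0 mulr0 raddf0 addr0.
- by rewrite -addn1 PoszD; apply/step.
- by apply/step; rewrite (_ : - n.+1%:Z + 1 = - n%:Z) //; lia.
Qed.

Section MuImage.
Variables (Q : form_parameter) (M N : qform Q).
Implicit Types u : seq M.

(** By [qf_muMz], [mu (e *~ n)] depends on [e] only through [mu e], since [lam e e = h (mu e)]. *)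
Lemma sum_muMz u (e : N) n : \sum_(x <- u) qf_mu x = qf_mu e ->
  \sum_(x <- u) qf_mu (x *~ n) = qf_mu (e *~ n).
Proof.
move=> uE; under eq_bigr do rewrite qf_muMz.
rewrite big_split /= -raddf_sum -mulr_suml qf_muMz.
have -> : \sum_(x <- u) qf_lam x x = qf_lam e e.
  by rewrite -qf_hmu -uE raddf_sum; apply: eq_bigr => x _; rewrite qf_hmu.
by congr (_ + _); rewrite -uE -mulrz_suml.
Qed.

End MuImage.

(** * Realising values and forms by sums over [M] *)

Section Realise.
Variables (Q : form_parameter) (M : qform Q).
Hypotheses (nsM : nonsingular M) (iM : indefinite M) (fM : full M).

(** Fullness gives [q] up to some [p n]; for a hyperbolic pair [v], [w] with vanishing [mu],
    [mu (v + w *~ n) = p n]. *)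
Lemma sum_mu_surj (q : Q) : exists u : seq M, \sum_(x <- u) qf_mu x = q.
Proof.
have [P [P1 P2 P12]] := hyperbolic_pair nsM iM.
have [x xq] := fM (to_linearisation q).
have [n nE] : exists n, q = qf_mu x + fp_p Q n.
  move/esym/eqP: xq; rewrite /Smu /to_linearisation -Quotient.idealrBE.
  by move=> /asboolP[n nE]; exists n; rewrite nE addrC subrK.
exists (x :: [seq r.1 + r.2 *~ n | r <- P]).
rewrite big_cons big_map nE; congr (_ + _).
under eq_bigr do rewrite qf_muD qf_lamMzr.
rewrite !big_split /= P1 add0r -raddf_sum -mulr_suml P12 mul1r.
have := @sum_muMz Q M M [seq r.2 | r <- P] 0 n.
by rewrite !big_map P2 mul0rz qf_mu0 => ->; rewrite ?add0r.
Qed.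

(* A morphism from [(A, l, m)] to the [size fs]-fold sum of [M], in components. *)
Definition sum_of_pullbacks (A : zmodType) (l : A -> A -> int) (m : A -> Q) :=
  exists fs : seq {additive A -> M},
    (forall x y, \sum_(f <- fs) qf_lam (f x) (f y) = l x y) /\
    (forall x, \sum_(f <- fs) qf_mu (f x) = m x).

Lemma sum_of_pullbacksD (A : zmodType) (l l' : A -> A -> int) (m m' : A -> Q) :
  sum_of_pullbacks l m -> sum_of_pullbacks l' m' ->
  sum_of_pullbacks (fun x y => l x y + l' x y) (fun x => m x + m' x).
Proof.
move=> [fs [lE mE]] [gs [lE' mE']]; exists (fs ++ gs).
by split=> *; rewrite big_cat /= ?lE ?lE' ?mE ?mE'.
Qed.

Lemma mulrz_additive_subproof (A B : zmodType) (phi : {additive A -> int}) (v : B) :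
  zmod_morphism (fun x => v *~ phi x).
Proof. by move=> x y; rewrite raddfB mulrzBr. Qed.

Lemma add_additive_subproof (A B : zmodType) (f g : {additive A -> B}) :
  zmod_morphism (fun x => f x + g x).
Proof. by move=> x y; rewrite !raddfB opprD addrACA. Qed.

(** The components in [u] together have the same [mu] as [e], hence the same norm, and can replace
    it in a rank one pullback. *)
Lemma sum_of_pullbacks_rank1 (N : qform Q) (phi : {additive N -> int}) (e : N) :
  sum_of_pullbacks (fun x y => qf_lam (e *~ phi x) (e *~ phi y))
                   (fun x => qf_mu (e *~ phi x)).
Proof.
have [u uE] := sum_mu_surj (qf_mu e).
exists [seq additive_of (mulrz_additive_subproof phi v) | v <- u].
split=> [x y|x]; rewrite big_map /=; last exact: sum_muMz.
under eq_bigr do rewrite qf_lamMzl qf_lamMzr.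
rewrite -!mulr_suml qf_lamMzl qf_lamMzr -qf_hmu -uE raddf_sum.
by congr (_ * _ * _); apply: eq_bigr => v _; rewrite qf_hmu.
Qed.

(** This is the pullback of the hyperbolic plane on a pair [v], [w] along
    [x |-> v *~ phi x + w *~ psi x]. *)
Lemma sum_of_pullbacks_hyperbolic (A : zmodType) (phi psi : {additive A -> int}) :
  sum_of_pullbacks
    (fun x y => phi x * psi y + fp_sym Q * (psi x * phi y))
    (fun x => fp_p Q (phi x * psi x)).
Proof.
have [P [P1 P2 P12]] := hyperbolic_pair nsM iM.
pose f (r : M * M) := add_additive_subproof (additive_of (mulrz_additive_subproof phi r.1))
                                  (additive_of (mulrz_additive_subproof psi r.2)).
have sum0 (F : M * M -> M) : \sum_(r <- P) qf_mu (F r) = 0 ->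
    \sum_(r <- P) qf_lam (F r) (F r) = 0.
  by move=> F0; under eq_bigr do rewrite -qf_hmu; rewrite -raddf_sum F0 raddf0.
exists [seq additive_of (f r) | r <- P].
split=> [x y|x]; rewrite big_map /=.
  under eq_bigr => r _.
    rewrite !(qf_lamDl, qf_lamDr) !(qf_lamMzl, qf_lamMzr).
    rewrite [qf_lam r.2 r.1]qf_lamC.
    over.
  rewrite !big_split /= -!mulr_suml -mulr_sumr sum0 // sum0 // P12.
  by ring.
under eq_bigr do rewrite qf_muD qf_lamMzl qf_lamMzr.
rewrite !big_split /= -!raddf_sum -!mulr_suml P12 mul1r.
have := @sum_muMz Q M M [seq r.1 | r <- P] 0 (phi x).
have := @sum_muMz Q M M [seq r.2 | r <- P] 0 (psi x).
by rewrite !big_map P1 P2 !mul0rz !qf_mu0 => -> // -> //; rewrite !add0r mulrC.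
Qed.

Definition expand (N : zmodType) (s : seq ({additive N -> int} * N)) (x : N) : N :=
  \sum_(t <- s) t.2 *~ t.1 x.

Lemma expandB (N : zmodType) (s : seq ({additive N -> int} * N)) :
  zmod_morphism (expand s).
Proof.
move=> x y; rewrite /expand -sumrB; apply: eq_bigr => t _.
by rewrite raddfB mulrzBr.
Qed.

(** Splitting off a term [e *~ phi x] leaves cross terms, which form the hyperbolic pullback along
    [phi] and [lam e (expand s x)]. *)
Lemma sum_of_pullbacks_expand (N : qform Q) (s : seq ({additive N -> int} * N)) :
  sum_of_pullbacks (fun x y => qf_lam (expand s x) (expand s y))
                   (fun x => qf_mu (expand s x)).
Proof.
elim: s => [|[phi e] s IH].
  exists [::]; split=> [x y|x]; rewrite /expand !big_nil ?qf_mu0 //.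
  by rewrite qf_lam0l.
have psiB : zmod_morphism (fun x => qf_lam e (expand s x)).
  by move=> x y; rewrite expandB; exact: (raddfB (adjoint e)).
have [fs [lE mE]] := sum_of_pullbacksD
  (sum_of_pullbacksD (sum_of_pullbacks_rank1 phi e)
                     (sum_of_pullbacks_hyperbolic phi (additive_of psiB))) IH.
have consE x : expand ((phi, e) :: s) x = e *~ phi x + expand s x.
  by rewrite /expand big_cons.
exists fs; split=> [x y|x].
  rewrite lE !consE !(qf_lamDl, qf_lamDr) !(qf_lamMzl, qf_lamMzr) /=.
  by rewrite [qf_lam (expand s x) e]qf_lamC; ring.
by rewrite mE consE qf_muD qf_lamMzl /= mulrC addrAC.
Qed.

End Realise.

(* [s] is extended step by step so that [x - expand s x] is killed by the
   first [m + 1] homomorphisms, dividing [phi m (x - expand s x)] by the generator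
   of its image. *)
Lemma dual_basis (A : zmodType) n (phi : 'I_n -> {additive A -> int}) :
  (forall x, (forall i, phi i x = 0) -> x = 0) ->
  exists s : seq ({additive A -> int} * A), forall x, x = expand s x.
Proof.
move=> sep.
suff [s sP] : exists s : seq ({additive A -> int} * A),
    forall (i : 'I_n) x, (i < n)%N -> phi i (x - expand s x) = 0.
  exists s => x; apply/eqP; rewrite -subr_eq0; apply/eqP.
  by apply: sep => i; apply: sP.
suff H m : (m <= n)%N -> exists s : seq ({additive A -> int} * A),
    forall (i : 'I_n) x, (i < m)%N -> phi i (x - expand s x) = 0 by exact: H.
elim: m => [|m IH] mn; first by exists [::].
have [s sP] := IH (ltnW mn); pose j := Ordinal mn.
have thB : zmod_morphism (fun x => phi j (x - expand s x)).
  by move=> x y; rewrite -[RHS]raddfB expandB !opprD addrACA.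
have [e [g /= gP]] := additive_int_image (additive_of thB).
(* Subtracting [expand s e] puts the new vector in the kernel of the earlier [phi i], while [phi j]
   takes the generator as its value there. *)
exists ((g, e - expand s e) :: s) => i x; rewrite ltnS leq_eqVlt.
have -> : x - expand ((g, e - expand s e) :: s) x =
    (x - expand s x) - (e - expand s e) *~ g x.
  by rewrite /expand big_cons -addrA -opprD; congr (x - _); rewrite addrC.
case/predU1P => [im|im].
  have -> : i = j by exact: val_inj.
  by rewrite raddfB /= additiveMz gP mulrz_int mulrC subrr.
by rewrite raddfB /= additiveMz !sP // mul0rz subr0.
Qed.

(** * Primitive embeddings into multiples of [M] *)

Section Embedding.
Variable Q : form_parameter.
Implicit Types M N : qform Q.

(** By nonsingularity, the pairings with generators of [N] separate points. *)
Lemma nonsingular_expand N : nonsingular N ->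
  exists s : seq ({additive N -> int} * N), forall x, x = expand s x.
Proof.
move=> nsN; have [n [g gP]] := qf_fg N.
apply: (@dual_basis _ n (fun i => adjoint (g i))) => x gx.
apply: nonsingular_lam_eq0 => // y; rewrite qf_lamC.
have [c ->] := gP y.
suff -> : qf_lam (\sum_i g i *~ c i) x = 0 by rewrite mulr0.
rewrite [LHS](raddf_sum (additive_of (qf_lamr_zmod x))) big1 // => i _ /=.
by rewrite qf_lamMzl; have /= -> := gx i; rewrite mul0r.
Qed.

Lemma morphism_primitive_embedding M N (f : {additive N -> M}) :
  nonsingular N -> qform_morphism f -> primitive_embedding f.
Proof.
move=> nsN fP; have [fl _] := fP; split=> //.
  move=> x y fxy; apply/eqP; rewrite -subr_eq0; apply/eqP.
  apply: nonsingular_lam_eq0 => // z.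
  by rewrite -fl raddfB /= fxy subrr qf_lam0l.
pose C : {pred M} := fun y => `[< forall x, qf_lam (f x) y = 0 >].
have CP : zmod_closed C.
  split=> [|x y /asboolP Cx /asboolP Cy]; apply/asboolP => z.
    by rewrite qf_lam0r.
  by rewrite qf_lamDr qf_lamNr Cx Cy subrr.
pose C' : zmodClosed M := HB.pack C (GRing.isZmodClosed.Build M C CP).
exists C'; split=> [_ [x <-] /asboolP Cx|y].
  rewrite (_ : x = 0) ?raddf0 //; apply: nonsingular_lam_eq0 => // z.
  by rewrite qf_lamC -fl Cx mulr0.
have fyB : zmod_morphism (fun x => qf_lam y (f x)).
  by move=> a b; rewrite raddfB qf_lamDr qf_lamNr.
(* [f x] is the orthogonal projection of [y] to the image of [f]. *)
have [x xP] := nonsingular_represent (additive_of fyB) nsN.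
exists (f x), (y - f x); split; [by exists x | | by rewrite addrC subrK].
apply/asboolP => z; rewrite qf_lamC qf_lamDl qf_lamNl fl xP /=.
by rewrite subrr mulr0.
Qed.

Lemma zero_additive_subproof (A B : zmodType) : zmod_morphism (fun _ : A => 0 : B).
Proof. by move=> x y; rewrite subr0. Qed.

Lemma kfold_morphism M N :
  sum_of_pullbacks M (@qf_lam Q N) (@qf_mu Q N) ->
  exists k, (0 < k)%N /\ exists f : {additive N -> kfold k M}, qform_morphism f.
Proof.
(* The zero map [z] is prepended to make [k] positive even if [fs] is empty. *)
move=> [fs [lE mE]]; pose z := additive_of (@zero_additive_subproof N M).
exists (size (z :: fs)); split=> //.
pose F x : kfold (size (z :: fs)) M := [ffun i : 'I__ => nth z (z :: fs) i x].
have FB : zmod_morphism F.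
  by move=> x y; apply/ffunP => i; rewrite !ffunE raddfB.
have sumE (R : nmodType) (G : {additive N -> M} -> R) :
    G z = 0 -> \sum_(i < size (z :: fs)) G (nth z (z :: fs) i) = \sum_(f <- fs) G f.
  by move=> G0; rewrite -(big_mkord xpredT (fun i => G (nth z (z :: fs) i)))
    -(big_nth z xpredT) big_cons G0 add0r.
exists (additive_of FB); split=> [x y|x] /=.
  rewrite /kfold_lam -lE -(sumE _ (fun f => qf_lam (f x) (f y))) ?qf_lam0l //.
  by apply: eq_bigr => i _; rewrite !ffunE.
rewrite /kfold_mu -mE -(sumE _ (fun f => qf_mu (f x))) ?qf_mu0 //.
by apply: eq_bigr => i _; rewrite !ffunE.
Qed.

Lemma indefinite_full_absorbing M :
  nonsingular M -> indefinite M -> full M -> absorbing M.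
Proof.
move=> nsM iM fM N nsN; have [s sP] := nonsingular_expand nsN.
have [fs [lE mE]] := sum_of_pullbacks_expand nsM iM fM s.
have [|k [k0 [f fP]]] := @kfold_morphism M N.
  by exists fs; split=> [x y|x]; rewrite (lE, mE) -!sP.
by exists k; split=> //; exists f; exact: morphism_primitive_embedding.
Qed.

End Embedding.

(** * The rank 2 test form *)

Lemma int_pair_basis (x : int * int) :
  x = (1, 0) *~ x.1 + (0, 1) *~ x.2.
Proof.
have E (y : int * int) n : y *~ n = (y.1 * n, y.2 * n).
  rewrite [LHS]surjective_pairing -!mulrz_int.
  by rewrite (raddfMz (@fst int int)) (raddfMz (@snd int int)).
rewrite !E [LHS]surjective_pairing; congr (_, _) => /=.
  by rewrite mul1r mul0r addr0.
by rewrite mul1r mul0r add0r.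
Qed.

Section Plane.
Variables (Q : form_parameter) (q : Q).
Local Notation eps := (fp_sym Q).
Local Notation h := (fp_h Q).
Local Notation p := (fp_p Q).

Definition plane_lam (x y : int * int) : int :=
  h q * (x.1 * y.1) + x.1 * y.2 + eps * (x.2 * y.1).

(** With [q] at [(1, 0)] and 0 at [(0, 1)], the sum rule and [qf_muMz] force this formula. *)
Definition plane_mu (x : int * int) : Q :=
  q *~ x.1 + p (h q * tri x.1 + x.1 * x.2).

Fact plane_fg : finitely_generated (int * int)%type.
Proof.
exists 2%N, (fun i => if i == 0 then (1, 0) else (0, 1)) => -[a b].
exists (fun i => if i == 0 then a else b).
by rewrite big_ord_recl big_ord1 /=; exact: int_pair_basis.
Qed.

Fact plane_lamDl x x' y : plane_lam (x + x') y = plane_lam x y + plane_lam x' y.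
Proof. by rewrite /plane_lam /=; ring. Qed.

Fact plane_lamDr x y y' : plane_lam x (y + y') = plane_lam x y + plane_lam x y'.
Proof. by rewrite /plane_lam /=; ring. Qed.

Fact plane_lamC x y : plane_lam x y = eps * plane_lam y x.
Proof.
rewrite /plane_lam !mulrDr !mulrA fp_sym_h fp_sym_sqr; ring.
Qed.

Fact plane_muD x y :
  plane_mu (x + y) = plane_mu x + plane_mu y + p (plane_lam x y).
Proof.
have -> : p (plane_lam x y) = p (h q * (x.1 * y.1) + x.1 * y.2 + x.2 * y.1).
  by rewrite /plane_lam [LHS]raddfD fp_p_sym -raddfD.
rewrite /plane_mu addrACA -mulrzDr -addrA -!raddfD /=.
by congr (_ + p _); rewrite triD; ring.
Qed.

Fact plane_hmu x : h (plane_mu x) = plane_lam x x.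
Proof.
rewrite /plane_mu /plane_lam !raddfD /= additiveMz mulrz_int !fp_hpE.
have : (1 + eps) * h q = 2 * h q by rewrite mulrDl fp_sym_h; ring.
rewrite mulrA => ->; have := triE x.1; set t := tri _ => tE.
have -> : 2 * h q * t = h q * (t * 2) by ring.
by rewrite tE; ring.
Qed.

Definition plane : qform Q :=
  QForm plane_fg plane_lamDl plane_lamDr plane_lamC plane_muD plane_hmu.

Lemma plane_nonsingular : nonsingular plane.
Proof.
(* The pair [(u, v)] solving [u = f (0, 1)] and [h q * u + eps * v = f (1, 0)]. *)
pose g (f : {additive plane -> int}) : plane :=
  (f (0, 1), eps * (f (1, 0) - h q * f (0, 1))).
have fE (f : {additive plane -> int}) (a b : int) :
    f (a, b) = f (1, 0) * a + f (0, 1) * b.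
  rewrite [X in f X = _](int_pair_basis (a, b)) [LHS]raddfD.
  by rewrite [f (_ *~ a)]additiveMz [f (_ *~ b)]additiveMz !mulrz_int.
exists g => [[a b]|f].
  rewrite /g /= /plane_lam /=; congr (_, _); first by ring.
  rewrite !(mulr0, mulr1, addr0, add0r) addrAC subrr add0r mulrA fp_sym_sqr mul1r.
  by [].
apply: additive_eq => -[a b]; rewrite [RHS]fE /= /plane_lam /=.
rewrite -[_ * _ * a]mulrA [eps * (eps * _)]mulrA fp_sym_sqr mul1r.
by set u := f (0, 1); set v := f (1, 0); ring.
Qed.

End Plane.

(** * Necessity of fullness and indefiniteness *)

Lemma to_linearisationD (Q : form_parameter) :
  {morph @to_linearisation Q : x y / x + y}.
Proof.
move=> x y; rewrite /to_linearisation.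
by rewrite -[RHS](@pi_addr _ _ _ _ _ (Quotient.quot (@im_p Q))).
Qed.

(** Since [Smu] is additive, the class of a [mu] value on [kfold k M] is attained on [M] itself. *)
Lemma Smu_sum (Q : form_parameter) (M : qform Q) k (y : kfold k M) :
  Smu (\sum_i y i) = to_linearisation (kfold_mu y).
Proof.
have to0 : to_linearisation (0 : Q) = 0.
  by have := to_linearisationD (0 : Q) 0; rewrite addr0 -[X in X = _]addr0 => /addrI.
rewrite /kfold_mu (big_morph _ (@to_linearisationD Q) to0).
by apply: big_morph => [x z|]; [exact: SmuD | rewrite /Smu qf_mu0].
Qed.

(** A sum of nonnegative terms vanishes only termwise; [s = 1] and [s = -1] give the two kinds of
    definite forms. *)
Lemma definite_kfold_anisotropic (Q : form_parameter) (M : qform Q) (s : int) k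
    (y : kfold k M) :
  (forall x : M, x != 0 -> 0 < s * qf_lam x x) -> kfold_lam y y = 0 -> y = 0.
Proof.
move=> sM; rewrite /kfold_lam => y0.
have : \sum_i s * qf_lam (y i) (y i) = 0 by rewrite -mulr_sumr y0 mulr0.
have ge0 i : 0 <= s * qf_lam (y i) (y i).
  have [->|/sM/ltW //] := eqVneq (y i) 0; by rewrite qf_lam0r mulr0.
move=> /psumr_eq0P sy; apply/ffunP => i; rewrite ffunE.
apply/eqP; apply/negP => /negP /sM; rewrite sy ?ltxx // => j _; exact: ge0.
Qed.

Lemma absorbing_full (Q : form_parameter) (M : qform Q) : absorbing M -> full M.
Proof.
move=> aM s.
have [q <-] : exists q, to_linearisation q = s by exists (repr s); exact: reprK.
have [k [_ [f [[_ fmu] _ _]]]] := aM _ (plane_nonsingular q).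
exists (\sum_i f (1, 0) i); rewrite Smu_sum; congr to_linearisation.
rewrite [LHS]fmu /= /plane_mu /= (_ : tri 1 = 0) // !mulr0 addr0 raddf0.
by rewrite addr0.
Qed.

Lemma absorbing_anisotropic (Q : form_parameter) (M : qform Q) (s : int) :
  absorbing M -> ~ (forall x : M, x != 0 -> 0 < s * qf_lam x x).
Proof.
move=> aM sM; have [k [_ [f [[flam _] finj _]]]] := aM _ (plane_nonsingular (0 : Q)).
have /(definite_kfold_anisotropic sM) f0 : kfold_lam (f (0, 1)) (f (0, 1)) = 0.
  by rewrite [LHS]flam /= /plane_lam /= !mulr0 mul0r addr0.
have : (0, 1) = 0 :> plane (0 : Q) by apply: finj; rewrite f0 raddf0.
by case.
Qed.

Theorem theorem1p8 (Q : form_parameter) (M : qform Q) (hM : nonsingular M) :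
  absorbing M <-> indefinite M /\ full M.
Proof.
split=> [aM|[iM fM]]; last exact: indefinite_full_absorbing.
split; last exact: absorbing_full.
split=> def; [apply: (absorbing_anisotropic (s := 1) aM)
             | apply: (absorbing_anisotropic (s := -1) aM)] => x /def.
  by rewrite mul1r.
by rewrite mulN1r oppr_gt0.
Qed.
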